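(* Let $X$ be a compact space and let $a,b,c\in X$. If $a$ and $b$ are pin equivalent in $X$ and $b$ and $c$ are pin equivalent in $X$, then $a$ and $c$ are pin equivalent in $X$.
   Context: All spaces are assumed to be Hausdorff. Points $a,b$ in a compact space $X$ are pin equivalent (in $X$) if there exist a compact space $Y$, a continuous surjection $f\colon Y\to X$, and a homeomorphism $g\colon Y\to Y$ such that $g(f^{-1}\{a\})=f^{-1}\{b\}$. *)

(* Defs.v *)
From mathcomp Require Import all_boot.
From mathcomp Require Import boolp classical_sets functions topology.

Set Implicit Arguments.
Unset Strict Implicit.
Unset Printing Implicit Defensive.

Local Open Scope classical_set_scope.

Definition compact_hausdorff (T : topologicalType) : Prop :=
  compact [set: T] /\ hausdorff_space T.

Definition homeomorphism (S T : topologicalType) (g : S -> T) : Prop :=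
  continuous g /\
  exists h : T -> S, [/\ continuous h, cancel g h & cancel h g].

Definition pin_equivalent (X : topologicalType) (a b : X) : Prop :=
  exists (Y : topologicalType) (f : Y -> X) (g : Y -> Y),
    [/\ compact_hausdorff Y,
        continuous f,
        set_surj [set: Y] [set: X] f,
        homeomorphism g &
        g @` (f @^-1` [set a]) = f @^-1` [set b]].

(* Main.v *)
Require Import Defs.
From mathcomp Require Import all_boot.
From mathcomp Require Import ssralg ssrint.
From mathcomp Require Import boolp classical_sets functions topology.

(** Call a compact Hausdorff space K with two continuous surjections
    u, v : K -> X such that u k = a iff v k = b a span from a to b.  If (Y, f, g)
    witnesses that a and b are pin equivalent, then (Y, f, f \o g) is a span.
    Conversely, a span yields the compact space of all bi-infinite sequences
    z in K^Z with v (z i) = u (z (i + 1)); together with z |-> u (z 0) and the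
    shift, which is a homeomorphism, it shows that a and b are pin equivalent.
    Spans, unlike pinnings, compose by pullback. *)

Set Implicit Arguments.
Unset Strict Implicit.
Unset Printing Implicit Defensive.

Import GRing.Theory.
Local Open Scope classical_set_scope.

(** If [x] is in the closure, any neighbourhoods of [f x] and [g x] share a value [f y = g y], so
    the Hausdorff property identifies the two points. This gives closedness of both the sequence
    space and the pullback. *)
Lemma continuous_eq_closed (S T : topologicalType) (f g : S -> T) :
  hausdorff_space T -> continuous f -> continuous g ->
  closed [set x | f x = g x].
Proof.
move=> hT cf cg x clx; apply: hT => A B /cf fA /cg gB.
have [y [/= fgy [Afy Bgy]]] := clx _ (@filterI _ (nbhs x) _ _ _ fA gB).
by exists (f y); split => //; rewrite fgy.
Qed.

Lemma hausdorff_continuous_inj (S T : topologicalType) (f : S -> T) :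
  continuous f -> injective f -> hausdorff_space T -> hausdorff_space S.
Proof.
move=> cf injf hT p q clpq; apply/injf/hT => A B /cf fA /cf fB.
by have [x [Ax Bx]] := clpq _ _ fA fB; exists (f x).
Qed.

Lemma hausdorff_prod (S T : topologicalType) :
  hausdorff_space S -> hausdorff_space T -> hausdorff_space (S * T)%type.
Proof.
move=> hS hT [p1 p2] [q1 q2] clpq; congr pair.
- apply: hS => A B pA qB.
  have [||x [Ax Bx]] := clpq (fst @^-1` A) (fst @^-1` B).
  + exact: (@cvg_fst _ _ (nbhs p1) (nbhs p2)).
  + exact: (@cvg_fst _ _ (nbhs q1) (nbhs q2)).
  + by exists x.1.
- apply: hT => A B pA qB.
  have [||x [Ax Bx]] := clpq (snd @^-1` A) (snd @^-1` B).
  + exact: (@cvg_snd _ _ (nbhs p1) (nbhs p2)).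
  + exact: (@cvg_snd _ _ (nbhs q1) (nbhs q2)).
  + by exists x.2.
Qed.

Lemma set_val_continuous (T : topologicalType) (A : set T) :
  continuous (set_val : A -> T).
Proof. exact: initial_continuous. Qed.

Lemma compact_hausdorff_closed (T : topologicalType) (A : set T) :
  closed A -> compact_hausdorff T -> compact_hausdorff A.
Proof.
move=> clA [cT hT]; split; last first.
  by apply: hausdorff_continuous_inj hT; [exact: set_val_continuous|exact: val_inj].
move=> F PF _; have PG : ProperFilter (set_val @ F) by exact: fmap_proper_filter.
(* The filter is pushed forward to [T], where the closed set [A] is compact. The cluster point found
   there lifts back, since neighbourhoods in the subspace are traces of open sets of [T]. *)
have [p [Ap clp]] : A `&` cluster (set_val @ F) !=set0.
  apply: (subclosed_compact clA cT) => //.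
  by apply: (@filterS _ F _ setT _ _ filterT) => x _; exact: set_valP.
exists (exist _ p (mem_set Ap)); split => // B C FB [_ [[V oV <-] Vp VC]].
have FB' : (set_val @ F) (set_val @` B).
  by apply: (@filterS _ F _ B) => // x Bx; exists x.
have [_ [[x Bx <-] Vx]] := clp _ _ FB' (open_nbhs_nbhs (conj oV Vp)).
by exists x; split => //; exact: VC.
Qed.

Lemma compact_hausdorff_prod (S T : topologicalType) :
  compact_hausdorff S -> compact_hausdorff T -> compact_hausdorff (S * T)%type.
Proof.
move=> [cS hS] [cT hT]; split; last exact: hausdorff_prod.
by rewrite -setXTT; exact: compact_setX.
Qed.

Lemma compact_hausdorff_product (I : eqType) (T : I -> topologicalType) :
  (forall i, compact_hausdorff (T i)) -> compact_hausdorff (prod_topology T).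
Proof.
move=> chT; split; last exact: (hausdorff_product (fun i => (chT i).2)).
rewrite (_ : setT = [set f : prod_topology T | forall i, [set: T i] (f i)]).
  exact: (tychonoff (fun i => (chT i).1)).
by apply/seteqP; split.
Qed.

Lemma continuous_product (S : topologicalType) (I : eqType)
    (T : I -> topologicalType) (f : S -> prod_topology T) :
  (forall i, continuous (fun x => f x i)) -> continuous f.
Proof.
move=> cf x; apply/cvg_sup => i A [_ [[V oV <-] Vfx VA]].
apply: filterS VA _; apply: (cf i x); exact: open_nbhs_nbhs.
Qed.

Section orbits.
Variables (X K : topologicalType) (u v : K -> X).
Hypotheses (hX : hausdorff_space X) (chK : compact_hausdorff K).
Hypotheses (cu : continuous u) (cv : continuous v).

Let seqs : topologicalType := prod_topology (fun _ : int => K).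

Definition orbits : set seqs := [set z | forall i, v (z i) = u (z (i + 1)%R)].

Lemma continuous_at (i : int) : continuous (fun z : seqs => z i).
Proof. exact: (@proj_continuous _ (fun _ : int => K)). Qed.

Lemma orbits_closed : closed orbits.
Proof.
rewrite (_ : orbits = \bigcap_(i in [set: int])
    [set z : seqs | v (z i) = u (z (i + 1)%R)]); last first.
  by apply/seteqP; split => z oz i => [_|]; exact: oz.
apply: closed_bigI => i _; apply: continuous_eq_closed => // z.
- by apply: continuous_comp; [exact: continuous_at|exact: cv].
- by apply: continuous_comp; [exact: continuous_at|exact: cu].
Qed.

Definition translate (d : int) (z : seqs) : seqs := fun i => z (i + d)%R.

Lemma translate_orbits d (z : orbits) : translate d (set_val z) \in orbits.
Proof. by apply: mem_set => i; rewrite /translate addrAC; exact: set_valP z _. Qed.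

(** Allowing any integer step makes the inverse of [shift 1] another instance, [shift (-1)], so one
    continuity proof serves both. *)
Definition shift (d : int) (z : orbits) : orbits :=
  exist _ (translate d (set_val z)) (translate_orbits d z).

Lemma shift_continuous d : continuous (shift d).
Proof.
apply: continuous_comp_initial; apply: continuous_product => i z.
apply: (@continuous_comp orbits seqs K set_val (fun y => y (i + d)%R)).
- exact: set_val_continuous.
- exact: continuous_at.
Qed.

Lemma shiftK d : cancel (shift d) (shift (- d)).
Proof.
by move=> z; apply/val_inj/funext => i; rewrite /= /translate set_valE /= /translate addrNK.
Qed.

Lemma shift_homeomorphism : homeomorphism (shift 1).
Proof.
split; first exact: shift_continuous.
exists (shift (-1)); split; [exact: shift_continuous|exact: shiftK|].
by move=> z; rewrite -{1}(opprK 1%R) shiftK.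
Qed.

(** Starting from [k] at index 0, surjectivity of [u] extends the sequence to the right and
    surjectivity of [v] extends it to the left. *)
Lemma orbit_through (k : K) :
  set_surj [set: K] [set: X] u -> set_surj [set: K] [set: X] v ->
  exists z : orbits, set_val z 0%R = k.
Proof.
move=> su sv.
have [s us] : {s : K -> K & forall k, u (s k) = v k}.
  by apply: (@choice _ _ (fun k l => u l = v k)) => l; have [m _ <-] := su (v l) I; exists m.
have [p vp] : {p : K -> K & forall k, v (p k) = u k}.
  by apply: (@choice _ _ (fun k l => v l = u k)) => l; have [m _ <-] := sv (u l) I; exists m.
(* [Negz n] stands for [-(n + 1)], hence [n.+1] predecessor steps. *)
pose z (i : int) := match i with Posz n => iter n s k | Negz n => iter n.+1 p k end.
have oz : orbits z.
  (* The index -1 is separate because its successor 0 crosses to the other branch of [z]. *)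
  case=> [n|[|n]] /=.
  - by rewrite addn1 /= us.
  - by rewrite vp.
  - by rewrite subn1 /= vp.
by exists (exist _ z (mem_set oz)).
Qed.

Lemma pin_equivalent_span (a b : X) :
  set_surj [set: K] [set: X] u -> set_surj [set: K] [set: X] v ->
  (forall k, u k = a <-> v k = b) -> pin_equivalent a b.
Proof.
move=> su sv uvab.
exists orbits, (fun z => u (set_val z 0%R)), (shift 1); split.
- apply: compact_hausdorff_closed orbits_closed _.
  exact: compact_hausdorff_product.
- move=> z; apply: continuous_comp; last exact: cu.
  apply: (@continuous_comp orbits seqs K set_val (fun y => y 0%R)).
  + exact: set_val_continuous.
  + exact: continuous_at.
- move=> x _; have [k _ <-] := su x I.
  by have [z z0] := orbit_through k su sv; exists z; rewrite ?z0.
- exact: shift_homeomorphism.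
(* By [uvab] and the orbit relation, [u (z 0) = a] iff [v (z 0) = b] iff [u (z 1) = b], and [z 1] is
   the entry at 0 of the shifted sequence. *)
- apply/seteqP; split => [_ [z za <-]|z zb] /=.
    by rewrite /translate -(set_valP z); apply/uvab.
  exists (shift (-1) z); last by rewrite -{1}(opprK 1%R) shiftK.
  by apply/uvab; rewrite (set_valP (shift (-1) z)) -[RHS]zb; congr (u (set_val z _)).
Qed.

End orbits.

Lemma pin_equivalent_to_span (X : topologicalType) (a b : X) :
  pin_equivalent a b ->
  exists (K : topologicalType) (u v : K -> X),
    [/\ compact_hausdorff K, continuous u /\ continuous v,
        set_surj [set: K] [set: X] u, set_surj [set: K] [set: X] v &
        forall k, u k = a <-> v k = b].
Proof.
move=> [Y [f [g [chY cf sf [cg [h [_ gK hK]]] gab]]]].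
exists Y, f, (f \o g); split => //.
- by split=> // y; apply: continuous_comp; [exact: cg|exact: cf].
- by move=> x _; have [y _ <-] := sf x I; exists (h y); rewrite //= hK.
- move=> y; split=> [fya|fgyb].
    by have : (f @^-1` [set b]) (g y) by rewrite -gab; exists y.
  (* A point of the fibre over [a] has image [g y]; injectivity of [g] shows that it is [y]
     itself. *)
  have : (g @` (f @^-1` [set a])) (g y) by rewrite gab.
  by case=> y' fy'a /(can_inj gK) <-.
Qed.

Theorem theorem2p9 (X : topologicalType) (a b c : X) :
  compact_hausdorff X ->
  pin_equivalent a b -> pin_equivalent b c -> pin_equivalent a c.
Proof.
move=> [_ hX] /pin_equivalent_to_span[K1 [u1 [v1 [ch1 [cu1 cv1] su1 sv1 ab]]]].
move=> /pin_equivalent_to_span[K2 [u2 [v2 [ch2 [cu2 cv2] su2 sv2 bc]]]].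
(* The pullback of [v1] and [u2] matches the two spans along their middle legs; the outer legs [u1]
   and [v2] then form a span from [a] to [c]. *)
pose P : set (K1 * K2)%type := [set k | v1 k.1 = u2 k.2].
have cfst : continuous (fst : K1 * K2 -> K1) by move=> k; exact: cvg_fst.
have csnd : continuous (snd : K1 * K2 -> K2) by move=> k; exact: cvg_snd.
have clP : closed P.
  apply: continuous_eq_closed => // k.
  - by apply: (continuous_comp (cfst k)); exact: cv1.
  - by apply: (continuous_comp (csnd k)); exact: cu2.
apply: (@pin_equivalent_span X P (u1 \o fst \o set_val) (v2 \o snd \o set_val)).
- exact: hX.
- exact: compact_hausdorff_closed clP (compact_hausdorff_prod ch1 ch2).
- move=> k; apply: (continuous_comp (@set_val_continuous _ _ k)).
  by apply: (continuous_comp (cfst _)); exact: cu1.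
- move=> k; apply: (continuous_comp (@set_val_continuous _ _ k)).
  by apply: (continuous_comp (csnd _)); exact: cv2.
- move=> x _; have [k1 _ <-] := su1 x I; have [k2 _ k12] := su2 (v1 k1) I.
  by exists (exist _ (k1, k2) (mem_set (esym k12))).
- move=> x _; have [k2 _ <-] := sv2 x I; have [k1 _ k12] := sv1 (u2 k2) I.
  by exists (exist _ (k1, k2) (mem_set k12)).
- move=> k /=; have := set_valP k; rewrite /P /= => k12.
  by rewrite ab k12 bc.
Qed.
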